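(* Let $\xi$, $\Lambda(\cdot)$, $B$, $\zeta$, $H$ and $\mathcal{G}$ satisfy the standing assumptions given in the context, let $G\in\mathcal{G}$, and put $\lambda_t=\mathrm{ess\,inf}\,\Lambda(t)$ and $\eta_t(u)=\xi(\Lambda(t)u)$, $u\in[0,1]$. Suppose that there exist a positive, increasing, continuous function $f(t)$ with $f(t)\to\infty$ as $t\to\infty$ and a non-negative (possibly degenerate) random variable $\Lambda$ such that the distributions of $\Lambda(t)/f(t)$ converge weakly to the distribution of $\Lambda$ as $t\to\infty$. Put $\hat\lambda=\mathrm{ess\,inf}\,\Lambda$ and assume that $\lambda_t/f(t)\to\hat\lambda$ as $t\to\infty$. Then, for every positive function $y_t$ with $y_t\to\infty$, $y_t=o(B(f(t)))$ and $f(t)\zeta(y_t)\to\infty$ as $t\to\infty$, $$\log\mathbf{P}\left(\eta_t(\cdot)\in Gy_t\right)=-\hat\lambda f(t)H(G)\zeta(y_t)(1+o(1))\quad\text{as }t\to\infty,$$ where in the case $\hat\lambda=0$ this relation is understood as $\log\mathbf{P}\left(\eta_t(\cdot)\in Gy_t\right)=o(f(t)\zeta(y_t))$ as $t\to\infty$.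
   Context: Standing assumptions. $\xi(t)$ and $\Lambda(t)$, $t\ge 0$, are independent real-valued stochastic processes on the same probability space. With probability 1, $\Lambda(t)$ has continuous trajectories, $\Lambda(t)\ge 0$ and $\Lambda(0)=0$; with probability 1, the trajectories of $\xi(t)$ are right continuous and $\xi(0)=0$. For $t\ge 0$ put $\xi_t(u)=\xi(tu)$, $u\in[0,1]$; trajectories of $\xi_t$ and of $\eta_t$ are regarded as elements of the Skorohod space $D[0,1]$. $\mathcal{G}$ is the collection of all sets $G=\{g\in D[0,1]: g(0)=0,\ -g_1(u)\le g(u)\le g_2(u)\text{ for all }u\in[0,1]\}$, where $g_1,g_2$ are positive, continuous, non-decreasing functions on $[0,1]$ (so $g_i(0)>0$). For real $a$, $aG=\{ag: g\in G\}$, and $Gy_t$ means $y_tG$. $B(t)$ and $\zeta(t)$, $t>0$, are positive functions and $H(G)$, $G\in\mathcal{G}$, is a positive functional such that $B(t)\to\infty$ and $\zeta(t)\to0$ as $t\to\infty$, $\limsup_{t\to\infty}B(ct)/B(t)<\infty$ for all $c>0$, and for every $G\in\mathcal{G}$ the relation $$\log\mathbf{P}\left(\xi_t(\cdot)\in Gy_t\right)=-tH(G)\zeta(y_t)(1+o(1))\quad\text{as }t\to\infty$$ holds for every positive function $y_t$ with $y_t\to\infty$, $y_t=o(B(t))$ and $t\zeta(y_t)\to\infty$ as $t\to\infty$. Notation: $\mathrm{ess\,inf}$ denotes the essential infimum of a random variable. The random variable $\Lambda$ (without argument) is the weak limit and is distinct from the process $\Lambda(t)$. *)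

(* Defs.v *)
From HB Require Import structures.
From mathcomp Require Import all_boot all_order all_algebra.
From mathcomp Require Import all_classical all_reals all_analysis.
From mathcomp Require Import ess_sup_inf.
Set Implicit Arguments.
Unset Strict Implicit.
Unset Printing Implicit Defensive.
Import Order.TTheory GRing.Theory Num.Theory.
Import numFieldNormedType.Exports.

Local Open Scope classical_set_scope.
Local Open Scope ring_scope.

(* A function on [0, 1] is represented by any total function R -> R with that
   restriction. The sets of functions below only constrain values on [0, 1],
   hence correspond bijectively to sets of functions on [0, 1]. *)
Definition skorohod01 (R : realType) : set (R -> R) :=
  [set g : R -> R | (forall u : R, 0 <= u < 1 -> g v @[v --> u^'+] --> g u) /\
           (forall u : R, 0 < u <= 1 -> cvg (g v @[v --> u^'-]))].

Definition boundary01 (R : realType) (g : R -> R) : Prop :=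
  [/\ forall u : R, 0 <= u <= 1 -> 0 < g u,
      {within `[0, 1], continuous g} &
      forall u v : R, 0 <= u -> u <= v -> v <= 1 -> g u <= g v].

Definition band (R : realType) (g1 g2 : R -> R) : set (R -> R) :=
  [set g : R -> R | [/\ skorohod01 g, g 0 = 0 &
             forall u : R, 0 <= u <= 1 -> - g1 u <= g u <= g2 u]].

Definition bands (R : realType) : set (set (R -> R)) :=
  [set G | exists g1 g2 : R -> R,
     [/\ boundary01 g1, boundary01 g2 & G = band g1 g2]].

Definition scale_set (R : realType) (a : R) (G : set (R -> R)) :
  set (R -> R) := [set a \*o g | g in G].

Definition process_sigma (R : realType) (d : measure_display)
    (T : measurableType d) (X : R -> T -> R) : set (set T) :=
  <<s [set E | exists t : R, exists A : set R,
         [/\ 0 <= t, measurable A & E = X t @^-1` A]] >>.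

Definition independent_processes (R : realType) (d : measure_display)
    (T : measurableType d) (P : probability T R) (X Y : R -> T -> R) : Prop :=
  forall E F : set T, process_sigma X E -> process_sigma Y F ->
    P (E `&` F) = (P E * P F)%E.

(* Path properties only hold almost surely, so an event on the paths of a
   process is in general measurable for the completion of P only; on such
   events the outer measure generated by P is the completed probability. *)
Definition path_prob (R : realType) (d : measure_display)
    (T : measurableType d) (P : probability T R) (X : T -> R -> R)
    (G : set (R -> R)) : \bar R :=
  mu_ext P [set w | G (X w)].

(* [ess_inf] takes values in \bar R; it is finite for a real random variable
   that is almost surely nonnegative, the only case where [fine] is used. *)
Definition ess_inf_fine (R : realType) (d : measure_display)
    (T : measurableType d) (P : probability T R) (X : T -> R) : R :=
  fine (ess_infr P X).

(* Intended for probability laws; [mu] and [nu] are unbundled so that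
   [pushforward] applies to functions without a bundled measurability proof. *)
Definition weak_cvg (R : realType) (mu : R -> set R -> \bar R)
    (nu : set R -> \bar R) : Prop :=
  forall h : R -> R, continuous h -> bounded_fun h ->
    (\int[mu t]_x (h x)%:E)%E @[t --> +oo] --> (\int[nu]_x (h x)%:E)%E.

(* log p(t) = r(t) (1 + o(1)) as t -> +oo. Since log 0 = -oo, this includes
   p(t) > 0 for all large t. *)
Definition log_equiv (R : realType) (p : R -> \bar R) (r : R -> R) : Prop :=
  exists2 e : R -> R, e t @[t --> +oo] --> 0 &
    \forall t \near +oo, lne (p t) = (r t * (1 + e t))%:E.

Definition log_littleo (R : realType) (p : R -> \bar R) (r : R -> R) : Prop :=
  exists2 e : R -> R, e t @[t --> +oo] --> 0 &
    \forall t \near +oo, lne (p t) = (r t * e t)%:E.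

(* Main.v *)
Require Import Defs.
From HB Require Import structures.
From mathcomp Require Import all_boot all_order all_algebra.
From mathcomp Require Import all_classical all_reals all_analysis.
From mathcomp Require Import ess_sup_inf measurable_realfun.
From mathcomp Require Import ring lra.
Set Implicit Arguments.
Unset Strict Implicit.
Unset Printing Implicit Defensive.
Import Order.TTheory GRing.Theory Num.Theory.
Import numFieldNormedType.Exports.

Local Open Scope classical_set_scope.
Local Open Scope ring_scope.

(* The boundaries of the band are nondecreasing, so running a path for a
   shorter time keeps it in the band, and the probability that xi_s lies in
   y_t G decreases in s. For c < lhat, Lambda(t) >= c f(t) almost surely for
   large t, so this probability at s = c f(t) bounds that of eta_t from above.
   For c > lhat, weak convergence keeps P(Lambda(t) <= c f(t)) away from 0 and
   independence gives the same bound from below up to a constant factor, which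
   is negligible because f(t) zeta(y_t) tends to infinity. Both bounds are
   estimated by the hypothesis on xi at times c f(t), and c tends to lhat.
   Since paths are right continuous, the band condition need only be tested at
   rational points; this turns the path events into measurable events of the
   sigma-algebra of xi, to which independence applies. *)

(** * Bands of paths, their rational form and changes of time *)

Definition in_tube (R : realType) (g1 g2 : R -> R) (y : R) : set (R -> R) :=
  [set h | forall u, 0 <= u <= 1 -> - (y * g1 u) <= h u <= y * g2 u].

Definition in_tube_rat (R : realType) (g1 g2 : R -> R) (y : R) :
    set (R -> R) :=
  [set h | forall q : rat, let u := ratr q : R in
           0 <= u <= 1 -> - (y * g1 u) <= h u <= y * g2 u].

(** If [k u] were negative, right continuity would make [k] negative on some interval to the right
    of [u], and that interval contains a rational. *)
Lemma right_continuous_rat_ge0 (R : realType) (k : R -> R) (u : R) :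
  0 <= u < 1 -> k v @[v --> u^'+] --> k u ->
  (forall q : rat, let v := ratr q : R in 0 <= v <= 1 -> 0 <= k v) -> 0 <= k u.
Proof.
move=> /andP[u0 u1] ku kq; rewrite leNgt; apply/negP => ku0.
have [e /= e0 He] := filterI (nbhs_right_lt u1) (cvgr_lt _ ku _ ku0).
have [q] : exists q : rat, ratr q \in `]u, u + e[.
  by apply: rat_in_itvoo; rewrite ltrDl.
rewrite in_itv/= => /andP[uq que].
have [|q1] := He (ratr q) _ uq.
  by rewrite /ball_/= ltr0_norm ?subr_lt0// opprB ltrBlDl.
by rewrite ltNge kq// (le_trans u0 (ltW uq)) ltW.
Qed.

Lemma boundary01_right_continuous (R : realType) (g : R -> R) (u : R) :
  boundary01 g -> 0 <= u < 1 -> g v @[v --> u^'+] --> g u.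
Proof.
move=> [_ gc _] /andP[u0 u1].
have /continuous_within_itvP : (0 < 1 :> R) by [].
move=> /(_ R R g)[/(_ gc)[gi g0 _] _].
move: u0; rewrite le_eqVlt => /predU1P[<-//|u0].
by apply: cvg_at_right_filter; apply: gi; rewrite in_itv/= u0.
Qed.

(** Each inequality is the nonnegativity of a right continuous function, [h + y g1] or [y g2 - h].
    The endpoint 1 cannot be approached from the right inside the interval, but it is itself
    rational. *)
Lemma in_tube_ratP (R : realType) (g1 g2 h : R -> R) (y : R) :
  boundary01 g1 -> boundary01 g2 -> skorohod01 h ->
  in_tube_rat g1 g2 y h -> in_tube g1 g2 y h.
Proof.
move=> G1 G2 [hr _] hq u /andP[u0].
rewrite le_eqVlt => /predU1P[->|u1].
  by have /= := hq 1; rewrite rmorph1 ler01 lexx; apply.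
have u01 : 0 <= u < 1 by rewrite u0.
apply/andP; split.
- rewrite -subr_ge0 opprK.
  apply: (@right_continuous_rat_ge0 _ (fun v => h v + y * g1 v)) => // [|q v].
    apply: cvgD; first exact: hr.
    by apply: cvgMl_tmp; exact: boundary01_right_continuous.
  by move=> /hq/andP[+ _]; rewrite -subr_ge0 opprK.
- rewrite -subr_ge0.
  apply: (@right_continuous_rat_ge0 _ (fun v => y * g2 v - h v)) => // [|q v].
    apply: cvgB; last exact: hr.
    by apply: cvgMl_tmp; exact: boundary01_right_continuous.
  by move=> /hq/andP[_ +]; rewrite -subr_ge0.
Qed.

(** The value at time [r * u] is the value at time [s * v] with [v = r / s * u <= u], and the bounds
    at [v] are at most those at [u] because the boundaries are nondecreasing. *)
Lemma in_tube_time_change (R : realType) (g1 g2 x : R -> R) (y r s : R) :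
  boundary01 g1 -> boundary01 g2 -> 0 < y -> 0 < s -> 0 <= r <= s ->
  in_tube g1 g2 y (fun u => x (s * u)) -> in_tube g1 g2 y (fun u => x (r * u)).
Proof.
move=> [_ _ G1] [_ _ G2] y0 s0 /andP[r0 rs] xs u /andP[u0 u1].
have ru : r * u = s * (r / s * u) by field; rewrite gt_eqF.
have le_u : r / s * u <= u.
  by rewrite ler_piMl// ler_pdivrMr// mul1r.
have ge_0 : 0 <= r / s * u by rewrite mulr_ge0// divr_ge0// ltW.
rewrite ru; have /andP[b1 b2] : - (y * g1 (r / s * u)) <= x (s * (r / s * u)) <=
    y * g2 (r / s * u) by apply: xs; rewrite ge_0 (le_trans le_u).
rewrite (le_trans _ b1) ?(le_trans b2)//.
  by rewrite ler_pM2l// G2.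
by rewrite lerN2 ler_pM2l// G1.
Qed.

Lemma scale_bandP (R : realType) (g1 g2 : R -> R) (y : R) (h : R -> R) :
  0 < y -> scale_set y (band g1 g2) h <->
  [/\ skorohod01 h, h 0 = 0 & in_tube g1 g2 y h].
Proof.
move=> y0; split.
  move=> [g [[gr gl] g00 gb] <-]; split.
  - split=> u u01 /=; first by apply: cvgMl_tmp; exact: gr.
    apply/cvg_ex; have /cvg_ex[l gl'] := gl u u01; exists (y * l).
    exact: cvgMl_tmp.
  - by rewrite /= g00 mulr0.
  - move=> u u01 /=; have /andP[b1 b2] := gb u u01.
    by rewrite -mulrN !ler_pM2l// b1 b2.
move=> [[hr hl] h0 hb]; exists (y^-1 \*o h); last first.
  by apply/funext => u /=; rewrite mulVKf ?gt_eqF.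
split.
- split=> u u01 /=; first by apply: cvgMl_tmp; exact: hr.
  apply/cvg_ex; have /cvg_ex[l hl'] := hl u u01; exists (y^-1 * l).
  exact: cvgMl_tmp.
- by rewrite /= h0 mulr0.
- by move=> u u01 /=; rewrite ler_pdivlMl// ler_pdivrMl// mulrN; exact: hb.
Qed.

(** * Outer measure against measurable events, up to null sets *)

Lemma mu_ext_le_ae (R : realType) (d : measure_display) (T : measurableType d)
    (mu : {measure set T -> \bar R}) (A E : set T) :
  measurable E -> {ae mu, forall w, A w -> E w} -> (mu_ext mu A <= mu E)%E.
Proof.
move=> mE [N [mN N0 AN]].
have AEN : A `<=` E `|` N.
  move=> w Aw; have [Ew|nEw] := pselect (E w); first by left.
  by right; apply: AN => /(_ Aw).
rewrite (le_trans (le_mu_ext mu AEN))// measurable_mu_extE; last exact: measurableU.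
have muN : mu N = 0%E := N0.
have /le_trans : (mu (E `|` N) <= mu E + mu N)%E := measureU2 mu mE mN.
by apply; rewrite muN adde0.
Qed.

Lemma mu_ext_ge_ae (R : realType) (d : measure_display) (T : measurableType d)
    (mu : {measure set T -> \bar R}) (A E : set T) :
  measurable E -> {ae mu, forall w, E w -> A w} -> (mu E <= mu_ext mu A)%E.
Proof.
move=> mE [N [mN N0 AN]].
have ENA : E `\` N `<=` A.
  by move=> w [Ew nNw]; apply: contrapT => nAw; apply/nNw/AN => /(_ Ew).
apply: le_trans (le_mu_ext mu ENA); rewrite measurable_mu_extE; last exact: measurableD.
have mEN : measurable (E `\` N) by exact: measurableD.
have muN : mu N = 0%E := N0.
have : (mu (E `\` N `|` N) <= mu (E `\` N) + mu N)%E := measureU2 mu mEN mN.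
rewrite muN adde0; apply: le_trans.
apply: le_measure; rewrite ?inE//; first exact: measurableU.
by move=> w Ew; have [Nw|nNw] := pselect (N w); [right|left].
Qed.

(** * Tube events and comparison of probabilities under a change of time *)

Definition tube_event (R : realType) (T : Type) (X : R -> T -> R)
    (g1 g2 : R -> R) (y s : R) : set T :=
  [set w | in_tube_rat g1 g2 y (fun u => X (s * u) w)].

Lemma process_sigma_tube_event (R : realType) (d : measure_display)
    (T : measurableType d) (X : R -> T -> R) (g1 g2 : R -> R) (y s : R) :
  0 <= s -> process_sigma X (tube_event X g1 g2 y s).
Proof.
move=> s0; rewrite /process_sigma; set C := (X in <<s X >>).
(* These sets live in the space carrying the sigma-algebra generated by [X], so [measurable] means
   membership in [process_sigma X] here. *)
pose F (q : rat) : set (g_sigma_algebraType C) :=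
  [set w | let u := ratr q : R in
           0 <= u <= 1 -> - (y * g1 u) <= X (s * u) w <= y * g2 u].
suff mF q : measurable (F q).
  rewrite (_ : tube_event _ _ _ _ _ = ~` \bigcup_q ~` F q); last first.
    rewrite setC_bigcup; apply/seteqP; split=> w /= Ew.
      by move=> q _; rewrite setCK; exact: Ew.
    by move=> q; have := Ew q I; rewrite setCK; apply.
  have : measurable (~` \bigcup_q ~` F q); last exact.
  by apply: measurableC; apply: bigcupT_measurable_rat => q; exact: measurableC.
have [u01|nu01] := boolP (0 <= (ratr q : R) <= 1); last first.
  rewrite (_ : F q = setT)//; apply/seteqP; split=> w // _.
  by rewrite /F/= => u01; rewrite u01 in nu01.
apply: sub_sigma_algebra; exists (s * ratr q).
exists `[- (y * g1 (ratr q)), y * g2 (ratr q)]%classic; split=> //.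
  by rewrite mulr_ge0//; case/andP: u01.
by apply/seteqP; split=> w /=; rewrite in_itv/= => Fw //; exact: Fw.
Qed.

Lemma process_sigma_measurable (R : realType) (d : measure_display)
    (T : measurableType d) (X : R -> T -> R) (E : set T) :
  (forall t, measurable_fun setT (X t)) -> process_sigma X E -> measurable E.
Proof.
move=> mX; apply: smallest_sub; first exact: sigma_algebra_measurable.
by move=> _ [t [A [_ mA ->]]]; rewrite -[X in measurable X]setTI; exact: mX.
Qed.

Lemma measurable_tube_event (R : realType) (d : measure_display)
    (T : measurableType d) (P : probability T R) (X : R -> {RV P >-> R})
    (g1 g2 : R -> R) (y s : R) :
  0 <= s -> measurable (tube_event X g1 g2 y s).
Proof.
move=> s0; have := @process_sigma_tube_event R d T X g1 g2 y s s0.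
apply: process_sigma_measurable.
by move=> t; exact: measurable_funPT.
Qed.

(** Almost surely, a path that stays in the band when run up to [V w] also does so when run up to
    the earlier time [s]. *)
Lemma path_prob_time_change_le (R : realType) (d : measure_display)
    (T : measurableType d) (P : probability T R) (X : R -> {RV P >-> R})
    (V : T -> R) (g1 g2 : R -> R) (y s : R) :
  boundary01 g1 -> boundary01 g2 -> 0 < y -> 0 < s ->
  {ae P, forall w, s <= V w} ->
  (path_prob P (fun w u => X (V w * u)%R w) (scale_set y (band g1 g2)) <=
   P (tube_event X g1 g2 y s))%E.
Proof.
move=> G1 G2 y0 s0 sV; apply: mu_ext_le_ae.
  by apply: measurable_tube_event; exact: ltW.
apply: filterS sV => w sVw /(scale_bandP _ _ _ y0)[_ X0 Xw].
have ssV : 0 <= s <= V w by rewrite ltW.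
have V0 : 0 < V w := lt_le_trans s0 sVw.
have Xs := @in_tube_time_change R g1 g2 (fun u => X u w) y s (V w) G1 G2 y0 V0 ssV Xw.
by move=> q u u01; exact: Xs.
Qed.

(** Where [Y t <= s], a path lying in the tube up to time [s] also does so up to [Y t]. Independence
    factors the probability of the intersection of the two events. *)
Lemma path_prob_time_change_ge (R : realType) (d : measure_display)
    (T : measurableType d) (P : probability T R) (X Y : R -> {RV P >-> R})
    (g1 g2 : R -> R) (y s t : R) :
  independent_processes P X Y ->
  {ae P, forall w, forall r : R, 0 <= r -> skorohod01 (fun u => X (r * u) w)} ->
  {ae P, forall w, X 0 w = 0} ->
  {ae P, forall w, 0 <= Y t w} ->
  boundary01 g1 -> boundary01 g2 -> 0 < y -> 0 < s -> 0 <= t ->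
  (P (tube_event X g1 g2 y s) * P [set w | Y t w <= s]%R <=
   path_prob P (fun w u => X (Y t w * u)%R w) (scale_set y (band g1 g2)))%E.
Proof.
move=> indep Xsk X0 Y0 G1 G2 y0 s0 t0.
have sY : process_sigma Y [set w | Y t w <= s].
  by apply: sub_sigma_algebra; exists t, `]-oo, s]%classic; split.
rewrite -indep//; last by apply: process_sigma_tube_event; exact: ltW.
apply: mu_ext_ge_ae.
  apply: measurableI; first by apply: measurable_tube_event; exact: ltW.
  by apply: process_sigma_measurable sY => r; exact: measurable_funPT.
apply: filterS3 Xsk X0 Y0 => w Xsk X0 Y0 [/= Ew Yw].
apply/(scale_bandP _ _ _ y0); split; [exact: Xsk|by rewrite mulr0|].
have sY' : 0 <= Y t w <= s by rewrite Y0.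
apply: (@in_tube_time_change R g1 g2 (fun u => X u w) y _ s) => //.
by apply: in_tube_ratP => //; apply: Xsk; exact: ltW.
Qed.

(** Turns the outer probabilities at deterministic times into probabilities of measurable events.
    The upper bound is the time change with constant [V = s]. *)
Lemma path_prob_tube_event (R : realType) (d : measure_display)
    (T : measurableType d) (P : probability T R) (X : R -> {RV P >-> R})
    (g1 g2 : R -> R) (y s : R) :
  {ae P, forall w, forall r : R, 0 <= r -> skorohod01 (fun u => X (r * u) w)} ->
  {ae P, forall w, X 0 w = 0} ->
  boundary01 g1 -> boundary01 g2 -> 0 < y -> 0 < s ->
  path_prob P (fun w u => X (s * u) w) (scale_set y (band g1 g2)) =
  P (tube_event X g1 g2 y s).
Proof.
move=> Xsk X0 G1 G2 y0 s0; apply/eqP; rewrite eq_le; apply/andP; split.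
  by apply: path_prob_time_change_le => //; exact: aeW.
apply: mu_ext_ge_ae; first by apply: measurable_tube_event; exact: ltW.
apply: filterS2 Xsk X0 => w Xsk X0 Ew.
apply/(scale_bandP _ _ _ y0); split; [by apply: Xsk; exact: ltW|by rewrite mulr0|].
by apply: in_tube_ratP => //; apply: Xsk; exact: ltW.
Qed.

(** * Weak convergence and essential infima *)

Lemma weak_cvg_mass_near (R : realType)
    (d : measure_display) (T : measurableType d) (P : probability T R)
    (d' : measure_display) (T' : measurableType d') (P' : probability T' R)
    (X : R -> T -> R) (L : T' -> R) (a b : R) :
  (forall t, measurable_fun setT (X t)) -> measurable_fun setT L -> a < b ->
  weak_cvg (fun t => pushforward P (X t)) (pushforward P' L) ->
  (0 < P' [set w | L w <= a]%R)%E ->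
  exists2 m : R, 0 < m & \forall t \near +oo, (m%:E <= P [set w | X t w <= b]%R)%E.
Proof.
move=> mX mL ab wXL La.
(* A continuous ramp, 1 up to [a] and 0 beyond [b]: it lies between the indicators of [x <= a] and
   [x <= b], so it can serve as test function for weak convergence. *)
pose h : R -> R := cst 1 \min (cst 0 \max (fun x => (b - x) / (b - a))).
have ba0 : 0 < b - a by rewrite subr_gt0.
have h_cont : continuous h.
  apply: min_fun_continuous; first exact: cst_continuous.
  apply: max_fun_continuous; first exact: cst_continuous.
  move=> x; apply: cvgMr_tmp; apply: cvgB; [exact: cvg_cst|exact: cvg_id].
have h0 x : 0 <= h x by rewrite /h/= le_min ler01 le_max lexx.
have h1 x : h x <= 1 by rewrite /h/= ge_min lexx.
have ha x : x <= a -> h x = 1.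
  move=> xa; apply/min_idPl; rewrite le_max; apply/orP; right.
  by rewrite ler_pdivlMr// mul1r lerD2l lerN2.
have hb x : b < x -> h x = 0.
  move=> bx; rewrite /h/= (max_idPl _) ?(min_idPr _)//.
  by rewrite ler_pdivrMr// mul0r subr_le0 ltW.
have h_bnd : bounded_fun (h : R -> R^o).
  exists 1; split=> // M M1 x _ /=; rewrite ger0_norm//.
  by rewrite (le_trans (h1 x))// ltW.
have mh : measurable_fun [set: R] (fun x : R => (h x)%:E).
  by apply/measurable_EFinP; exact: continuous_measurable_fun.
have mXb t : measurable [set w | X t w <= b].
  rewrite (_ : [set _ | _] = X t @^-1` `]-oo, b]); last first.
    by apply/seteqP; split=> w /=; rewrite in_itv.
  by rewrite -[X in measurable X]setTI; exact: mX.
have mLa : measurable [set w | L w <= a].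
  rewrite (_ : [set _ | _] = L @^-1` `]-oo, a]); last first.
    by apply/seteqP; split=> w /=; rewrite in_itv.
  by rewrite -[X in measurable X]setTI; exact: mL.
have Lh : (P' [set w | L w <= a]%R <= \int[pushforward P' L]_x (h x)%:E)%E.
  rewrite (ge0_integral_pushforward mL)//=; last by move=> x _; rewrite lee_fin.
  rewrite -[X in P' X]setIT -integral_indic//; apply: ge0_le_integral => //=.
  - by apply/measurable_EFinP; exact: measurable_indic.
  - exact: (measurableT_comp mh mL).
  move=> w _; rewrite lee_fin indicE; case: (boolP (_ \in _)) => //.
  by rewrite inE/= => /ha ->.
have Xh t : (\int[pushforward P (X t)]_x (h x)%:E <= P [set w | X t w <= b]%R)%E.
  rewrite (ge0_integral_pushforward (mX t))//=; last by move=> x _; rewrite lee_fin.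
  rewrite preimage_setT.
  rewrite -[X in P X]setIT -integral_indic//; apply: ge0_le_integral => //=.
  - by move=> w _; rewrite lee_fin.
  - exact: (measurableT_comp mh (mX t)).
  - by apply/measurable_EFinP; exact: measurable_indic.
  move=> w _; rewrite lee_fin indicE; case: (boolP (_ \in _)) => //.
  by rewrite notin_setE/= => /negP; rewrite -ltNge => /hb ->.
have Pfin : P' [set w | L w <= a] \is a fin_num by exact: fin_num_measure.
have m0 : 0 < fine (P' [set w | L w <= a]).
  by rewrite fine_gt0// La ltey_eq Pfin.
(* Half the limiting mass is strictly below the limit integral, so the integrals exceed it for all
   large [t]. *)
exists (fine (P' [set w | L w <= a]) / 2); first by rewrite divr_gt0.
have m_lt : ((fine (P' [set w | L w <= a]%R) / 2)%:E <
    \int[pushforward P' L]_x (h x)%:E)%E.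
  by apply: lt_le_trans Lh; rewrite -[ltRHS]fineK// lte_fin ltr_pdivrMr// ltr_pMr// ltr1n.
have nbhs_gt : nbhs (\int[pushforward P' L]_x (h x)%:E)%E
    [set z | ((fine (P' [set w | L w <= a]%R) / 2)%:E < z)%E].
  by apply: open_nbhs_nbhs; split=> //; exact: open_ereal_gt_ereal.
near=> t; apply: le_trans (Xh t); apply: ltW; near: t.
exact: (wXL h h_cont h_bnd _ nbhs_gt).
Unshelve. all: by end_near. Qed.

(** Since [fine] sends infinite values to 0, the condition [0 < s] excludes the value -oo; at +oo
    the bound is trivial. *)
Lemma ess_infr_ae_ge (R : realType) (d : measure_display) (T : measurableType d)
    (P : probability T R) (X : T -> R) (s : R) :
  0 < s -> s <= ess_inf_fine P X -> {ae P, forall w, s <= X w}.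
Proof.
move=> s0; rewrite /ess_inf_fine => sX.
have : (s%:E <= ess_infr P X)%E.
  move: sX; case: (ess_infr P X) => [r||]/=.
  - by rewrite lee_fin.
  - by rewrite leey.
  - by rewrite leNgt s0.
by move=> /ess_infP; apply: filterS => w /=; rewrite lee_fin.
Qed.

Lemma ess_inf_fine_ge0 (R : realType) (d : measure_display)
    (T : measurableType d) (P : probability T R) (X : T -> R) :
  {ae P, forall w, 0 <= X w} -> 0 <= ess_inf_fine P X.
Proof.
move=> X0; apply: fine_ge0; apply/ess_infP.
by apply: filterS X0 => w /=; rewrite lee_fin.
Qed.

(** If the event were null, [c] would be an almost sure lower bound and hence at most the essential
    infimum. *)
Lemma ess_inf_fine_lt (R : realType) (d : measure_display)
    (T : measurableType d) (P : probability T R) (X : T -> R) (c : R) :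
  measurable_fun setT X -> {ae P, forall w, 0 <= X w} ->
  ess_inf_fine P X < c -> (0 < P [set w | X w <= c]%R)%E.
Proof.
move=> mX X0 Xc; rewrite lt0e measure_ge0 andbT; apply/eqP => PX.
have mXc : measurable [set w | X w <= c].
  rewrite (_ : [set _ | _] = X @^-1` `]-oo, c]); last first.
    by apply/seteqP; split=> w /=; rewrite in_itv.
  by rewrite -[X in measurable X]setTI; exact: mX.
have cX : {ae P, forall w, c%:E <= (EFin \o X) w}%E.
  exists [set w | X w <= c]; split=> // w /=.
  by rewrite lee_fin => /negP; rewrite -ltNge => /ltW.
have X0' : {ae P, forall w, 0 <= (EFin \o X) w}%E.
  by apply: filterS X0 => w /=; rewrite lee_fin.
move/ess_infP : cX; move/ess_infP : X0'; move: Xc; rewrite /ess_inf_fine.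
case E : (ess_infr P X) => [r||]//=; first by move=> rc _; rewrite lee_fin leNgt rc.
(* The value +oo remains: it would make the real-valued [X] infinite almost everywhere, so the whole
   space would be null. *)
move=> _ _ _; move/ess_inf_eqyP : E => [N [mN N0 /= XN]].
have NT : N = setT by apply/seteqP; split=> // w _; exact: XN.
have : P setT = 0%E by rewrite -NT; exact: N0.
by rewrite probability_setT => /eqP; rewrite onee_eq0.
Qed.

(** * Logarithmic asymptotics: reparametrization and squeezing *)

Lemma lne_EFin_inv (R : realType) (x : \bar R) (r : R) :
  lne x = r%:E -> x = (expR r)%:E.
Proof. by case: x => [x||]//=; case: leP => // x0 [<-]; rewrite lnK. Qed.

Lemma limf_esup_near_le (R : realType) (F : R -> R) :
  (limf_esup (fun t => (F t)%:E) (pinfty_nbhs R) < +oo)%E ->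
  exists2 M : R, 0 < M & \forall t \near +oo, F t <= M.
Proof.
rewrite limf_esupE => /ereal_inf_lt[_ [V oV <-]] supV.
(* The maximum with 1 makes the bound positive, so that it can be divided by. *)
exists (Num.max 1 (fine (ereal_sup [set (F x)%:E | x in V]))).
  by rewrite lt_max ltr01.
apply: filterS oV => t Vt.
have Ft : ((F t)%:E <= ereal_sup [set (F x)%:E | x in V])%E.
  by apply: ereal_sup_ubound; exists t.
rewrite le_max; apply/orP; right.
by move: supV Ft; case: (ereal_sup _).
Qed.

(* The hypothesis on Q is applied to z = y o g, where g is a right inverse of
   c * f near infinity. *)
Lemma log_equiv_reparam (R : realType) (Q : R -> R -> \bar R)
    (B zeta f y : R -> R) (h c : R) :
  0 < c ->
  (forall t : R, 0 < t -> 0 < B t) ->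
  (limf_esup (fun t : R => (B (c^-1 * t) / B t)%:E) (pinfty_nbhs R) < +oo)%E ->
  (forall z : R -> R, (forall t : R, 0 < t -> 0 < z t) ->
     z t @[t --> +oo] --> +oo -> z t / B t @[t --> +oo] --> 0 ->
     t * zeta (z t) @[t --> +oo] --> +oo ->
     log_equiv (fun t => Q t (z t)) (fun t => - (t * h * zeta (z t)))) ->
  (forall t : R, 0 < t -> 0 < f t) -> (forall s t : R, 0 < s -> s < t -> f s < f t) ->
  {within `]0, +oo[, continuous f} -> f t @[t --> +oo] --> +oo ->
  (forall t : R, 0 < t -> 0 < y t) -> y t @[t --> +oo] --> +oo ->
  y t / B (f t) @[t --> +oo] --> 0 ->
  f t * zeta (y t) @[t --> +oo] --> +oo ->
  log_equiv (fun t => Q (c * f t) (y t))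
            (fun t => - (c * f t * h * zeta (y t))).
Proof.
move=> c0 B0 Blim ldp f0 f_incr f_cont fy y0 yy yB yz.
(* The default 1 keeps [g] positive even where [s / c] is not a value of [f]. *)
pose g s := xget 1 [set t | 0 < t /\ f t = s / c].
have g0 s : 0 < g s by rewrite /g; case: xgetP => [t _ []//|_]; exact: ltr01.
have f_inj s t : 0 < s -> 0 < t -> f s = f t -> s = t.
  move=> s0 t0 fst; case: (ltgtP s t) => // [/(f_incr _ _ s0)|/(f_incr _ _ t0)];
    by rewrite fst ltxx.
have gK t : 0 < t -> g (c * f t) = t.
  move=> t0; have [] : [set r | 0 < r /\ f r = c * f t / c] (g (c * f t)).
    by apply: xgetPex; exists t; split=> //; rewrite mulrC mulKf ?gt_eqF.
  rewrite [c * _]mulrC mulfK ?gt_eqF// => gt0 /f_inj -> //.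
(* For large [s] the value [s / c] exceeds [f 1], and the intermediate value theorem on [[1, t]]
   with [f t > s / c] yields a preimage. *)
have fK : \forall s \near +oo, f (g s) = s / c.
  near=> s; have sc : f 1 < s / c.
    by rewrite ltr_pdivlMr//; near: s; exact: nbhs_pinfty_gt (num_real _).
  suff [t t0 fts] : exists2 t, 0 < t & f t = s / c.
    by have [] : [set r | 0 < r /\ f r = s / c] (g s); first by apply: xgetPex; exists t.
  have [t [t1 st]] : exists t, 1 <= t /\ s / c < f t.
    have /cvgryPgt/(_ (s / c)) fsc := fy.
    have [t [tt ft]] := filter_ex (filterI (nbhs_pinfty_ge (num_real 1)) fsc).
    by exists t.
  have [||u] := @IVT _ f 1 t (s / c) t1.
  - apply: continuous_subspaceW f_cont => u /=; rewrite !in_itv/= andbT.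
    by case/andP=> u1 _; exact: lt_le_trans u1.
  - by rewrite ge_min le_max (ltW sc) (ltW st) orbT.
  by rewrite in_itv/= => /andP[u1 _] <-; exists u => //; exact: lt_le_trans u1.
have gy : g s @[s --> +oo] --> +oo.
  apply/cvgryPgt => A; near=> s.
  have A0 : 0 < Num.max 1 A by rewrite lt_max ltr01.
  have : f (Num.max 1 A) < f (g s).
    rewrite (near fK s)// ltr_pdivlMr//; near: s; exact: nbhs_pinfty_gt (num_real _).
  case: (ltP A (g s)) => // gsA; rewrite ltNge le_eqVlt => /negP[].
  have : g s <= Num.max 1 A by rewrite le_max gsA orbT.
  rewrite le_eqVlt => /predU1P[->|gs]; first by rewrite eqxx.
  by rewrite (f_incr _ _ (g0 s) gs) orbT.
have [||||e e0 He] := ldp (y \o g).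
- by move=> t _; exact: y0.
- exact: cvg_comp gy yy.
- have [M M0 BM] := limf_esup_near_le Blim.
  apply/cvgr0Pnorm_lt => eps eps0.
  have epsM : 0 < eps / M by rewrite divr_gt0.
  have yBg := cvg_comp _ _ gy yB.
  near=> s.
  have s0 : 0 < s by near: s; exact: nbhs_pinfty_gt (num_real _).
  have Bs : 0 < B s by exact: B0.
  have Bcs : 0 < B (c^-1 * s) by apply: B0; rewrite mulr_gt0 ?invr_gt0.
  have yBs : `|y (g s) / B (f (g s))| < eps / M.
    by near: s; move/cvgr0Pnorm_lt : yBg; exact.
  (* As [f (g s) = s / c], the known quotient is multiplied by [B (s / c) / B s], which the limsup
     hypothesis bounds by [M]. *)
  have -> : y (g s) / B s = y (g s) / B (f (g s)) * (B (c^-1 * s) / B s).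
    rewrite (near fK s)// [s / c]mulrC; field.
    by rewrite !gt_eqF.
  rewrite normrM [`|B _ / _|]gtr0_norm ?divr_gt0//.
  rewrite -(divfK (lt0r_neq0 M0) eps).
  apply: (@le_lt_trans _ _ (`|y (g s) / B (f (g s))| * M)); last by rewrite ltr_pM2r.
  by rewrite ler_wpM2l//; near: s.
- apply: (cvg_trans _ (gt0_cvgMry c0 (cvg_comp _ _ gy yz))).
  apply: near_eq_cvg; near=> s.
  by rewrite /= (near fK s)//; field; rewrite gt_eqF.
(* The relation obtained in [s] is read at [s = c * f t], where [g s = t]. *)
have cfy : c * f t @[t --> +oo] --> +oo by exact: gt0_cvgMry.
exists (fun t => e (c * f t)); first exact: cvg_comp cfy e0.
have := cfy _ He; rewrite /= => He'; near=> t.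
have t0 : 0 < t by near: t; exact: nbhs_pinfty_gt (num_real _).
have : lne (Q (c * f t) ((y \o g) (c * f t))) =
   (- (c * f t * h * zeta ((y \o g) (c * f t))) * (1 + e (c * f t)))%:E.
  by near: t.
by rewrite /= gK.
Unshelve. all: by end_near. Qed.

(** The rate [a t = - ln (p t) / (h * r t)] is kept above [l - eps] by the bounds with [c < l] and
    below [l + eps] by those with [c > l]. The factor [m] only adds [ln m], which is negligible
    because [r] tends to infinity. *)
Lemma log_rate_squeeze (R : realType) (p : R -> \bar R) (r : R -> R) (h l : R) :
  0 < h -> r t @[t --> +oo] --> +oo -> (forall t, (p t <= 1)%E) ->
  (forall c : R, 0 < c -> c < l ->
     exists2 q, log_equiv q (fun t => - (c * h * r t)) &
                \forall t \near +oo, (p t <= q t)%E) ->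
  (forall c : R, l < c ->
     exists q, exists2 m : R, 0 < m &
       log_equiv q (fun t => - (c * h * r t)) /\
       \forall t \near +oo, (m%:E * q t <= p t)%E) ->
  0 <= l ->
  exists2 a : R -> R, a t @[t --> +oo] --> l &
    \forall t \near +oo, lne (p t) = (- (a t * h * r t))%:E.
Proof.
move=> h0 ry p1 p_le p_ge l0.
have l1 : l < l + 1 by rewrite ltrDl.
pose x t := fine (lne (p t)).
have r_gt A : \forall t \near +oo, A < r t by move/cvgryPgt : ry; exact.
have hr0 : \forall t \near +oo, 0 < h * r t.
  near=> t; rewrite mulr_gt0//; near: t; exact: r_gt.
(* The lower bound [m * q t] is positive, so [p t] is too, and [x t] is its true logarithm rather
   than a default value of [fine]. *)
have xlo c : l < c -> exists2 e : R -> R, e t @[t --> +oo] --> 0 &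
    exists m, \forall t \near +oo, p t = (expR (x t))%:E /\
      ln m - c * h * r t * (1 + e t) <= x t.
  move=> /p_ge[q [m m0 [[e e0 qe] qp]]]; exists e => //; exists m.
  near=> t.
  have qE : q t = (expR (- (c * h * r t) * (1 + e t)))%:E.
    by apply: lne_EFin_inv; near: t.
  have : (m%:E * q t <= p t)%E by near: t.
  rewrite /x qE -EFinM; have := p1 t; case: (p t) => [s||]//= _.
  rewrite lee_fin => ms.
  have mq0 : 0 < m * expR (- (c * h * r t) * (1 + e t)).
    by rewrite mulr_gt0// expR_gt0.
  have s0 : 0 < s := lt_le_trans mq0 ms.
  rewrite leNgt s0/= lnK//; split=> //.
  rewrite -mulNr -(expRK (- _ * _)) -lnM ?posrE ?expR_gt0//.
  by rewrite ler_ln ?posrE.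
have xhi c : 0 < c -> c < l -> exists2 e : R -> R, e t @[t --> +oo] --> 0 &
    \forall t \near +oo, x t <= - (c * h * r t * (1 + e t)).
  move=> c0 cl; have [q [e e0 qe] pq] := p_le c c0 cl; exists e => //.
  (* The choice [l + 1] serves only to know that [p t] is positive. *)
  have [e' _ [m xm]] := xlo (l + 1) l1.
  near=> t.
  have qE : q t = (expR (- (c * h * r t) * (1 + e t)))%:E.
    by apply: lne_EFin_inv; near: t.
  have [pE _] : p t = (expR (x t))%:E /\
      ln m - (l + 1) * h * r t * (1 + e' t) <= x t by near: t.
  have : (p t <= q t)%E by near: t.
  by rewrite pE qE lee_fin ler_expR mulNr.
have e_small (c eps : R) (e : R -> R) : 0 < c -> 0 < eps ->
    e t @[t --> +oo] --> 0 -> \forall t \near +oo, `|c * e t| < eps.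
  move=> c0 eps0 /cvgr0Pnorm_lt/(_ (eps / c)); rewrite divr_gt0// => /(_ isT).
  by apply: filterS => t; rewrite ltr_pdivlMr// normrM (gtr0_norm c0) mulrC.
exists (fun t => - x t / (h * r t)); last first.
  have [e _ [m xm]] := xlo (l + 1) l1.
  near=> t.
  have [-> _] : p t = (expR (x t))%:E /\
      ln m - (l + 1) * h * r t * (1 + e t) <= x t by near: t.
  rewrite lne_EFin ?expR_gt0// expRK; congr EFin.
  by rewrite -mulrA divfK ?opprK// lt0r_neq0//; near: t.
apply/cvgrPdist_lt => eps eps0.
have eps2 : 0 < eps / 2 by rewrite divr_gt0.
have eps4 : 0 < eps / 4 by rewrite divr_gt0.
(* Taking [c = l + eps / 2] leaves [eps / 4] for the error [c * e t] and [eps / 4] for [- ln m]. *)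
have upper : \forall t \near +oo, - x t / (h * r t) < l + eps.
  have lc : l < l + eps / 2 by rewrite ltrDl.
  have c0 : 0 < l + eps / 2 := le_lt_trans l0 lc.
  have [e e0 [m xm]] := xlo _ lc.
  near=> t.
  have hrt : 0 < h * r t by near: t.
  rewrite ltr_pdivrMr//.
  have [_] : p t = (expR (x t))%:E /\
      ln m - (l + eps / 2) * h * r t * (1 + e t) <= x t by near: t.
  have : `|(l + eps / 2) * e t| < eps / 4 by near: t; exact: e_small.
  rewrite ltr_norml => /andP[_ ce].
  have rm : - ln m < eps / 4 * (h * r t).
    rewrite mulrA -ltr_pdivrMl ?mulr_gt0//; near: t; exact: r_gt.
  have : (l + eps / 2) * e t * (h * r t) < eps / 4 * (h * r t) by rewrite ltr_pM2r.
  lra.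
have lower : \forall t \near +oo, l - eps < - x t / (h * r t).
  have [lc|lc] := ltP 0 (l - eps / 2).
    have cl : l - eps / 2 < l by rewrite ltrBlDr ltrDl.
    have [e e0 xc] := xhi _ lc cl.
    near=> t.
    have hrt : 0 < h * r t by near: t.
    rewrite ltr_pdivlMr//.
    have : x t <= - ((l - eps / 2) * h * r t * (1 + e t)) by near: t.
    have : `|(l - eps / 2) * e t| < eps / 4 by near: t; exact: e_small.
    rewrite ltr_norml => /andP[ce _].
    have : - (eps / 4) * (h * r t) < (l - eps / 2) * e t * (h * r t).
      by rewrite ltr_pM2r.
    have : 0 < eps * (h * r t) by rewrite mulr_gt0.
    lra.
  (* Here [l <= eps / 2], so [l - eps] is negative, while [p t <= 1] makes the rate nonnegative. *)
  near=> t.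
  have hrt : 0 < h * r t by near: t.
  apply: (@lt_le_trans _ _ 0); first by lra.
  rewrite divr_ge0 ?(ltW hrt)// oppr_ge0.
  have : (lne (p t) <= 0)%E by rewrite lne_le0.
  by rewrite /x; case: (lne _).
near=> t; rewrite ltr_distlC; apply/andP; split; near: t; [exact: lower|exact: upper].
Unshelve. all: by end_near. Qed.

(** * The asymptotics of the time-changed process *)

Lemma path_prob_le1 (R : realType) (d : measure_display)
    (T : measurableType d) (P : probability T R) (X : T -> R -> R)
    (G : set (R -> R)) : (path_prob P X G <= 1)%E.
Proof.
rewrite /path_prob -(@probability_setT _ _ _ P) -(measurable_mu_extE P)//.
exact: le_mu_ext.
Qed.

Theorem theorem2 (R : realType)
  (d : measure_display) (T : measurableType d) (P : probability T R)
  (xi Lambda : R -> {RV P >-> R})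
  (B zeta : R -> R) (H : set (R -> R) -> R)
  (indep : independent_processes P xi Lambda)
  (Lambda_paths : {ae P, forall w,
     [/\ {within `[0, +oo[, continuous (fun t : R => Lambda t w)},
         forall t : R, 0 <= t -> 0 <= Lambda t w & Lambda 0 w = 0]})
  (xi_paths : {ae P, forall w,
     (forall t : R, 0 <= t -> xi s w @[s --> t^'+] --> xi t w) /\ xi 0 w = 0})
  (xi_skorohod : {ae P, forall w,
     forall t : R, 0 <= t -> skorohod01 (fun u => xi (t * u) w)})
  (B_gt0 : forall t : R, 0 < t -> 0 < B t)
  (zeta_gt0 : forall t : R, 0 < t -> 0 < zeta t)
  (H_gt0 : forall G : set (R -> R), bands G -> 0 < H G)
  (B_pinfty : B t @[t --> +oo] --> +oo)
  (zeta_0 : zeta t @[t --> +oo] --> 0)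
  (B_limsup : forall c : R, 0 < c ->
     (limf_esup (fun t : R => (B (c * t) / B t)%:E) (pinfty_nbhs R) < +oo)%E)
  (xi_ldp : forall G : set (R -> R), bands G -> forall y : R -> R,
     (forall t : R, 0 < t -> 0 < y t) ->
     y t @[t --> +oo] --> +oo ->
     y t / B t @[t --> +oo] --> 0 ->
     t * zeta (y t) @[t --> +oo] --> +oo ->
     log_equiv
       (fun t : R => path_prob P (fun w u => xi (t * u) w) (scale_set (y t) G))
       (fun t : R => - (t * H G * zeta (y t))))
  (G : set (R -> R)) (G_band : bands G)
  (f : R -> R)
  (f_gt0 : forall t : R, 0 < t -> 0 < f t)
  (f_incr : forall s t : R, 0 < s -> s < t -> f s < f t)
  (f_cont : {within `]0, +oo[, continuous f})
  (f_pinfty : f t @[t --> +oo] --> +oo)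
  (d' : measure_display) (T' : measurableType d') (P' : probability T' R)
  (L : {RV P' >-> R})
  (L_ge0 : {ae P', forall w, 0 <= L w})
  (Lambda_weak : weak_cvg
     (fun t : R => pushforward P (fun w => Lambda t w / f t))
     (pushforward P' L))
  (lambda_cvg :
     ess_inf_fine P (Lambda t) / f t @[t --> +oo] --> ess_inf_fine P' L)
  (y : R -> R)
  (y_gt0 : forall t : R, 0 < t -> 0 < y t)
  (y_pinfty : y t @[t --> +oo] --> +oo)
  (y_littleo : y t / B (f t) @[t --> +oo] --> 0)
  (y_zeta : f t * zeta (y t) @[t --> +oo] --> +oo) :
  let p := fun t : R => path_prob P (fun w u => xi (Lambda t w * u) w)
                                (scale_set (y t) G) in
  let lhat := ess_inf_fine P' L in
  (lhat != 0 ->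
     log_equiv p (fun t : R => - (lhat * f t * H G * zeta (y t)))) /\
  (lhat = 0 ->
     log_littleo p (fun t : R => f t * zeta (y t))).
Proof.
move=> p lhat; have [g1 [g2 [G1 G2 GE]]] := G_band.
have X0 : {ae P, forall w, xi 0 w = 0} by apply: filterS xi_paths => w [].
have Lam0 t : 0 <= t -> {ae P, forall w, 0 <= Lambda t w}.
  by move=> t0; apply: filterS Lambda_paths => w [_ + _]; exact.
have lhat0 : 0 <= lhat by exact: ess_inf_fine_ge0.
(* The comparison probability: [xi] run up to the deterministic time [c * f t]. *)
pose q c t := path_prob P (fun w u => xi (c * f t * u) w) (scale_set (y t) G).
have qE c t : 0 < c -> 0 < t ->
    q c t = P (tube_event xi g1 g2 (y t) (c * f t)).
  move=> c0 t0; rewrite /q GE; apply: path_prob_tube_event => //.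
  - exact: y_gt0.
  - by rewrite mulr_gt0// f_gt0.
have q_ldp c : 0 < c -> log_equiv (q c) (fun t => - (c * H G * (f t * zeta (y t)))).
  move=> c0.
  have -> : (fun t => - (c * H G * (f t * zeta (y t)))) =
            (fun t => - (c * f t * H G * zeta (y t))).
    by apply/funext => t; ring.
  apply: (@log_equiv_reparam R
    (fun s z => path_prob P (fun w u => xi (s * u) w) (scale_set z G)) B) => //.
  - by apply: B_limsup; rewrite invr_gt0.
  - exact: xi_ldp.
have p_le c : 0 < c -> c < lhat -> \forall t \near +oo, (p t <= q c t)%E.
  move=> c0 cl; near=> t.
  have t0 : 0 < t by near: t; exact: nbhs_pinfty_gt (num_real _).
  have ft0 := f_gt0 _ t0.
  rewrite qE// /p GE; apply: path_prob_time_change_le => //.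
  - exact: y_gt0.
  - exact: mulr_gt0.
  apply: ess_infr_ae_ge; first exact: mulr_gt0.
  rewrite -ler_pdivlMr//; apply: ltW; near: t.
  exact: cvgr_gt lambda_cvg _ cl.
have p_ge c : lhat < c -> exists2 m : R, 0 < m &
    \forall t \near +oo, (m%:E * q c t <= p t)%E.
  move=> cl; have c0 : 0 < c := le_lt_trans lhat0 cl.
  (* The bound [lhat < a] gives [L <= a] positive probability, and [a < c] leaves room for the ramp
     in the weak convergence. *)
  have [a la ac] : exists2 a, lhat < a & a < c.
    by exists ((lhat + c) / 2); lra.
  have mLf t : measurable_fun setT (fun w => Lambda t w / f t).
    by apply: measurable_funM => //; exact: measurable_cst.
  have mL : measurable_fun setT (L : T' -> R) by exact: measurable_funPT.
  have [m m0 mP] := weak_cvg_mass_near mLf mL ac Lambda_weak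
    (ess_inf_fine_lt mL L_ge0 la).
  exists m => //; near=> t.
  have t0 : 0 < t by near: t; exact: nbhs_pinfty_gt (num_real _).
  have ft0 := f_gt0 _ t0.
  rewrite qE// /p GE.
  apply: le_trans (@path_prob_time_change_ge _ _ _ _ _ _ _ _ _ (c * f t) t
    indep xi_skorohod X0 (Lam0 _ (ltW t0)) G1 G2 (y_gt0 _ t0) (mulr_gt0 c0 ft0)
    (ltW t0)).
  rewrite muleC; apply: lee_wpmul2l; first exact: measure_ge0.
  have -> : [set w | Lambda t w <= c * f t] = [set w | Lambda t w / f t <= c].
    by apply/seteqP; split=> w /=; rewrite ler_pdivrMr.
  by near: t.
have [||||a al pa] := @log_rate_squeeze R p (fun t => f t * zeta (y t)) (H G) lhat
  (H_gt0 _ G_band) y_zeta.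
- by move=> t; exact: path_prob_le1.
- by move=> c c0 cl; exists (q c); [exact: q_ldp|exact: p_le].
- move=> c cl; have [m m0 mp] := p_ge c cl; exists (q c); exists m => //.
  by split=> //; apply: q_ldp; exact: le_lt_trans cl.
- by [].
split=> [l_neq0|l_eq0].
(* The relative error of the rate [a t], which tends to [lhat]. *)
- exists (fun t => a t / lhat - 1).
    rewrite -(subrr (1 : R)) -[X in _ --> X - _](divff l_neq0).
    by apply: cvgB; [exact: cvgMr_tmp|exact: cvg_cst].
  apply: filterS pa => t ->; congr EFin; field.
  by rewrite l_neq0.
(* With limit 0, the rate itself, up to the constant [- H G], is the little-o factor. *)
- exists (fun t => - (a t * H G)).
    by rewrite -oppr0 -(mul0r (H G)) -l_eq0; apply: cvgN; exact: cvgMr_tmp.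
  by apply: filterS pa => t ->; congr EFin; ring.
Unshelve. all: by end_near. Qed.
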